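(* Let $\mathcal{C}$ be a small strict monoidal braided Ab-category with braiding $c$, let $S_0$ be an infinite set, and let $\mathcal{C}^{S_0}$ be the associated braided monoidal category (defined in the context). Let $\theta$ be a twist for the category $\mathcal{C}$. Then the category $\mathcal{C}^{S_0}$ has a twist $\Theta_f:f\to f$ given by $$\Theta_f(x,y)=\delta_{x,y}\theta_{f(x)}:f(x)\to f(y)$$ for any object $f$ of $\mathcal{C}^{S_0}$ and $x,y\in S_f$.
   Context: An Ab-category is a category whose hom-sets are additive abelian groups with bilinear composition; in a monoidal Ab-category the tensor product of morphisms is also assumed bilinear. A twist in a braided monoidal category with braiding $c$ is a natural family of isomorphisms $\theta_V:V\to V$ with $\theta_{V\otimes W}=c_{W,V}\,c_{V,W}\,(\theta_V\otimes\theta_W)$ for all objects $V,W$. The category $\mathcal{C}^{S_0}$. Objects are functions $f:S_f\to \mathrm{Obj}(\mathcal{C})$ with $S_f\subset S_0$ any subset. A morphism $F:f\to g$ is a function on $S_f\times S_g$ assigning to $(x,y)$ a morphism $F(x,y):f(x)\to g(y)$ of $\mathcal{C}$ such that, if $S_g$ is infinite, for each $x\in S_f$ there is a finite set $S^F_x\subset S_g$ with $F(x,y)=0$ for $y\in S_g\setminus S_x^F$. Composition is $(G\circ F)(x,y)=\sum_{z\in S_g}G(z,y)\circ F(x,z)$; identities are $\mathrm{Id}_f(x,y)=\delta_{x,y}\mathrm{id}_{f(x)}$ (here and throughout, $\delta$ times a morphism means that morphism when the indices agree and the zero morphism otherwise). Monoidal structure. Fix a bijection $\gamma:S_0\times S_0\to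 S_0$ and a point $\ast\in S_0$. For objects $f,g$, $f\otimes g:\gamma(S_f\times S_g)\to\mathrm{Obj}(\mathcal{C})$ is $(f\otimes g)(\gamma(x,y))=f(x)\otimes g(y)$. The unit object is $\mathrm{I}:\{\ast\}\to \mathrm{Obj}(\mathcal{C})$, $\ast\mapsto \mathrm{I}$. For morphisms $F:f\to f'$, $G:g\to g'$, $(F\otimes G)(\gamma(x,y),\gamma(x',y'))=F(x,x')\otimes G(y,y')$. The associativity constraint $A_{f,g,h}:(f\otimes g)\otimes h\to f\otimes(g\otimes h)$ is $A_{f,g,h}(\gamma(\gamma(x,y),z),\gamma(x',\gamma(y',z')))=\delta_{x,x'}\delta_{y,y'}\delta_{z,z'}\mathrm{id}_{f(x)\otimes g(y)\otimes h(z)}$; the units $R_f:f\otimes\mathrm{I}\to f$, $L_f:\mathrm{I}\otimes f\to f$ are $R_f(\gamma(x,\ast),x')=\delta_{x,x'}\mathrm{id}_{f(x)}$ and $L_f(\gamma(\ast,x),x')=\delta_{x,x'}\mathrm{id}_{f(x)}$. The braiding $C_{f,g}:f\otimes g\to g\otimes f$ is $C_{f,g}(\gamma(x,y),\gamma(y',x'))=\delta_{x,x'}\delta_{y,y'}c_{f(x),g(y)}$. *)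

(* Defs.v *)
From HB Require Import structures.
From mathcomp Require Import all_boot all_algebra finmap.
From mathcomp Require Import mathcomp_extra boolp classical_sets functions.
From mathcomp Require Import cardinality fsbigop.

Set Implicit Arguments.
Unset Strict Implicit.
Unset Printing Implicit Defensive.
Import GRing.Theory.
Local Open Scope classical_set_scope.
Local Open Scope ring_scope.

Record category := Category {
  obj :> Type;
  Hom : obj -> obj -> Type;
  idm : forall X, Hom X X;
  mcomp : forall X Y Z, Hom Y Z -> Hom X Y -> Hom X Z;
  compA : forall X Y Z T (h : Hom Z T) (g : Hom Y Z) (f : Hom X Y),
    mcomp h (mcomp g f) = mcomp (mcomp h g) f;
  comp1m : forall X Y (f : Hom X Y), mcomp (idm Y) f = f;
  compm1 : forall X Y (f : Hom X Y), mcomp f (idm X) = f }.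

Arguments Hom {c} _ _.
Arguments idm {c} X.
Arguments mcomp {c X Y Z} _ _.

Notation "g \oc f" := (mcomp g f) (at level 40, left associativity).

Definition is_iso (C : category) (X Y : C) (f : Hom X Y) : Prop :=
  exists g : Hom Y X, g \oc f = idm X /\ f \oc g = idm Y.

Record monoidal (C : category) := Monoidal {
  tens : C -> C -> C;
  tunit : C;
  tensm : forall X X' Y Y' : C,
    Hom X X' -> Hom Y Y' -> Hom (tens X Y) (tens X' Y');
  tensm_id : forall X Y : C, tensm (idm X) (idm Y) = idm (tens X Y);
  tensm_comp : forall (X X' X'' Y Y' Y'' : C)
      (f' : Hom X' X'') (f : Hom X X') (g' : Hom Y' Y'') (g : Hom Y Y'),
    tensm (f' \oc f) (g' \oc g) = tensm f' g' \oc tensm f g;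
  assoc : forall X Y Z : C, Hom (tens (tens X Y) Z) (tens X (tens Y Z));
  assocV : forall X Y Z : C, Hom (tens X (tens Y Z)) (tens (tens X Y) Z);
  assocK : forall X Y Z,
    assocV X Y Z \oc assoc X Y Z = idm (tens (tens X Y) Z);
  assocVK : forall X Y Z,
    assoc X Y Z \oc assocV X Y Z = idm (tens X (tens Y Z));
  assoc_nat : forall (X X' Y Y' Z Z' : C)
      (f : Hom X X') (g : Hom Y Y') (h : Hom Z Z'),
    assoc X' Y' Z' \oc tensm (tensm f g) h
    = tensm f (tensm g h) \oc assoc X Y Z;
  runit : forall X : C, Hom (tens X tunit) X;
  runit_iso : forall X, is_iso (runit X);
  runit_nat : forall (X X' : C) (f : Hom X X'),
    runit X' \oc tensm f (idm tunit) = f \oc runit X;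
  lunit : forall X : C, Hom (tens tunit X) X;
  lunit_iso : forall X, is_iso (lunit X);
  lunit_nat : forall (X X' : C) (f : Hom X X'),
    lunit X' \oc tensm (idm tunit) f = f \oc lunit X;
  pentagon : forall X Y Z T : C,
    tensm (idm X) (assoc Y Z T) \oc assoc X (tens Y Z) T
      \oc tensm (assoc X Y Z) (idm T)
    = assoc X Y (tens Z T) \oc assoc (tens X Y) Z T;
  triangle : forall X Y : C,
    tensm (idm X) (lunit Y) \oc assoc X tunit Y = tensm (runit X) (idm Y) }.

Definition eqm (C : category) (X Y : C) (e : X = Y) : Hom X Y :=
  eq_rect X (@Hom C X) (idm X) Y e.

Definition strict (C : category) (M : monoidal C) : Prop :=
  [/\ forall X Y Z : C,
        exists e : tens M (tens M X Y) Z = tens M X (tens M Y Z),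
          assoc M X Y Z = eqm e,
      forall X : C, exists e : tens M X (tunit M) = X, runit M X = eqm e
    & forall X : C, exists e : tens M (tunit M) X = X, lunit M X = eqm e].

Record braiding (C : category) (M : monoidal C) := Braiding {
  braid : forall X Y : C, Hom (tens M X Y) (tens M Y X);
  braid_iso : forall X Y, is_iso (braid X Y);
  braid_nat : forall (X X' Y Y' : C) (f : Hom X X') (g : Hom Y Y'),
    braid X' Y' \oc tensm M f g = tensm M g f \oc braid X Y;
  hexagon1 : forall X Y Z : C,
    assoc M Y Z X \oc braid X (tens M Y Z) \oc assoc M X Y Z
    = tensm M (idm Y) (braid X Z) \oc assoc M Y X Z
        \oc tensm M (braid X Y) (idm Z);
  hexagon2 : forall X Y Z : C,
    assocV M Z X Y \oc braid (tens M X Y) Z \oc assocV M X Y Z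
    = tensm M (braid X Z) (idm Y) \oc assocV M X Z Y
        \oc tensm M (idm X) (braid Y Z) }.

Definition is_twist (C : category) (M : monoidal C) (B : braiding M)
    (theta : forall V : C, Hom V V) : Prop :=
  [/\ forall V : C, is_iso (theta V),
      forall (V W : C) (f : Hom V W), theta W \oc f = f \oc theta V
    & forall V W : C,
        theta (tens M V W)
        = braid B W V \oc braid B V W \oc tensm M (theta V) (theta W)].

(* Equality of arrows compares morphisms whose endpoints are only
    propositionally equal. *)

Section Arrows.
Variable C : category.

Record arrow := Arrow { asrc : C; atgt : C; amor : Hom asrc atgt }.

Lemma arrow_inj (X Y : C) (f g : Hom X Y) : Arrow f = Arrow g -> f = g.
Proof.
move=> fg.
pose cast (a : arrow) (p : asrc a = X) (q : atgt a = Y) : Hom X Y :=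
  eq_rect _ (fun Z => Hom Z Y) (eq_rect _ (Hom (asrc a)) (amor a) _ q) _ p.
have castE a b p q p' q' : a = b -> cast a p q = cast b p' q'.
  by move=> ab; subst b; rewrite (Prop_irrelevance p p') (Prop_irrelevance q q').
exact: (castE (Arrow f) (Arrow g) erefl erefl erefl erefl fg).
Qed.

(* Composition of arrows, with a junk value when they are not composable. *)
Definition acomp (b a : arrow) : arrow :=
  match pselect (atgt a = asrc b) with
  | left e =>
      Arrow (amor b \oc eq_rect _ (Hom (asrc a)) (amor a) _ e)
  | right _ => a
  end.

Lemma acompE (X Y Z : C) (g : Hom Y Z) (f : Hom X Y) :
  acomp (Arrow g) (Arrow f) = Arrow (g \oc f).
Proof.
rewrite /acomp; case: pselect => //= e.
by rewrite (Prop_irrelevance e erefl).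
Qed.

Definition atens (M : monoidal C) (a b : arrow) : arrow :=
  Arrow (tensm M (amor a) (amor b)).

End Arrows.

Arguments Arrow {C asrc atgt} amor.

Record ab_category := AbCategory {
  ab_obj : Type;
  ab_hom : ab_obj -> ab_obj -> zmodType;
  ab_id : forall X, ab_hom X X;
  ab_comp : forall X Y Z, ab_hom Y Z -> ab_hom X Y -> ab_hom X Z;
  ab_compA : forall X Y Z T
      (h : ab_hom Z T) (g : ab_hom Y Z) (f : ab_hom X Y),
    ab_comp h (ab_comp g f) = ab_comp (ab_comp h g) f;
  ab_comp1m : forall X Y (f : ab_hom X Y), ab_comp (ab_id Y) f = f;
  ab_compm1 : forall X Y (f : ab_hom X Y), ab_comp f (ab_id X) = f;
  ab_compDl : forall X Y Z (g g' : ab_hom Y Z) (f : ab_hom X Y),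
    ab_comp (g + g') f = ab_comp g f + ab_comp g' f;
  ab_compDr : forall X Y Z (g : ab_hom Y Z) (f f' : ab_hom X Y),
    ab_comp g (f + f') = ab_comp g f + ab_comp g f' }.

Arguments ab_hom {a} _ _.
Arguments ab_comp {a X Y Z} _ _.

Definition ab_cat (A : ab_category) : category :=
  Category (@ab_compA A) (@ab_comp1m A) (@ab_compm1 A).
Coercion ab_cat : ab_category >-> category.

Definition ab_tensm (A : ab_category) (M : monoidal A) (X X' Y Y' : A)
    (f : ab_hom X X') (g : ab_hom Y Y') :
    ab_hom (tens M X Y) (tens M X' Y') :=
  tensm M f g.

Definition bilinear_tens (A : ab_category) (M : monoidal A) : Prop :=
  (forall (X X' Y Y' : A) (f f' : ab_hom X X') (g : ab_hom Y Y'),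
     ab_tensm M (f + f') g = ab_tensm M f g + ab_tensm M f' g)
  /\ (forall (X X' Y Y' : A) (f : ab_hom X X') (g g' : ab_hom Y Y'),
     ab_tensm M f (g + g') = ab_tensm M f g + ab_tensm M f g').

(* [fsum F] is the sum of [F] if its support is finite, and 0 otherwise. *)
Definition fsum (T : Type) (V : zmodType) (F : T -> V) : V :=
  \sum_(z \in [set: {classic T}]) F z.

Definition fsupp (T : Type) (V : zmodType) (F : T -> V) :=
  finite_set [set z | F z <> 0].

Lemma fsumE (T : Type) (V : zmodType) (F : T -> V) (r : seq {classic T}) :
  uniq r -> (forall z : {classic T}, F z <> 0 -> z \in r) ->
  fsum F = \sum_(z <- r) F z.
Proof.
move=> ur rF; rewrite /fsum (@fsbigE _ _ _ _ _ r)//.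
  by apply: congr_big => // i; rewrite in_setT.
by move=> z _ /negP zr; apply: contrapT => Fz; apply: zr; exact: rF.
Qed.

Lemma fsupp_seq (T : Type) (V : zmodType) (F : T -> V) : fsupp F ->
  exists2 r : seq {classic T}, uniq r & forall z : {classic T}, F z <> 0 -> z \in r.
Proof.
move=> fF; exists (fset_set ([set z | F z <> 0] : set {classic T})).
  exact: fset_uniq.
by move=> z Fz; rewrite in_fset_set// inE.
Qed.

Lemma fsum1 (T : Type) (V : zmodType) (F : T -> V) (z0 : T) :
  (forall z, z <> z0 -> F z = 0) -> fsum F = F z0.
Proof.
move=> F0; rewrite (@fsumE _ _ _ [:: z0 : {classic T}])//.
  by rewrite big_seq1.
move=> z Fz; rewrite inE; apply/eqP; apply: contrapT => zz0; apply: Fz; exact: F0.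
Qed.

Lemma fsum_map (T : Type) (V W : zmodType) (h : V -> W) (F : T -> V) :
  (forall a b, h (a + b) = h a + h b) -> fsupp F ->
  h (fsum F) = fsum (fun z => h (F z)).
Proof.
move=> hD /fsupp_seq[r ur rF].
have h0 : h 0 = 0 by apply: (addrI (h 0)); rewrite -hD !addr0.
rewrite (fsumE ur rF) (fsumE ur); first exact: big_morph.
by move=> z hFz; apply: rF => Fz; apply: hFz; rewrite Fz.
Qed.

Lemma eq_fsum (T : Type) (V : zmodType) (F G : T -> V) : F =1 G ->
  fsum F = fsum G.
Proof. by move=> /funext ->. Qed.

Lemma fsum_exchange (T U : Type) (V : zmodType) (F : T -> U -> V)
    (r : seq {classic T}) (s : seq {classic U}) : uniq r -> uniq s ->
  (forall t u, F t u <> 0 -> ((t : {classic T}) \in r)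
                          && ((u : {classic U}) \in s)) ->
  fsum (fun t => fsum (F t)) = fsum (fun u => fsum (fun t => F t u)).
Proof.
move=> ur us rs.
have F1 t : fsum (F t) = \sum_(u <- s) F t u.
  by apply: fsumE => // u /rs/andP[].
have F2 u : fsum (fun t => F t u) = \sum_(t <- r) F t u.
  by apply: fsumE => // t /rs/andP[].
rewrite (eq_fsum F1) (eq_fsum F2) (fsumE ur); last first.
  move=> t; apply: contra_notT => tr; rewrite big1// => u _.
  by apply: contrapT => /rs/andP[]; rewrite (negbTE tr).
rewrite (fsumE us) 1?exchange_big//.
move=> u; apply: contra_notT => tr; rewrite big1// => t _.
by apply: contrapT => /rs/andP[_]; rewrite (negbTE tr).
Qed.

Section Power.
Variables (C : ab_category) (S0 : Type).

Record pobj := PObj {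
  psupp : set S0;
  pval :> psupp -> C }.

Record pmor (f g : pobj) := PMor {
  pmat :> forall (x : psupp f) (y : psupp g), ab_hom (f x) (g y);
  pmat_fin : infinite_set (psupp g) -> forall x : psupp f,
    exists A : set S0, [/\ finite_set A, A `<=` psupp g
      & forall y : psupp g, ~ A (val y) -> pmat x y = 0] }.

Lemma pmor_eq (f g : pobj) (F G : pmor f g) :
  (forall x y, F x y = G x y) -> F = G.
Proof.
case: F G => [F Ff] [G Gf] /= FG; have {}FG : F = G.
  by apply: functional_extensionality_dep => x;
     apply: functional_extensionality_dep => y; exact: FG.
by rewrite -FG in Gf *; congr PMor; exact: Prop_irrelevance.
Qed.

Lemma pmat_supp (f g : pobj) (F : pmor f g) (x : psupp f) :
  finite_set [set y | F x y <> 0].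
Proof.
have [fg|/(pmat_fin F)/(_ x)[A [fA Ag A0]]] := pselect (finite_set (psupp g)).
  apply: (@sub_finite_set _ _ ((val : psupp g -> S0) @^-1` psupp g)).
    by move=> y _ /=; exact/set_mem/valP.
  by apply: finite_preimage => // u v _ _; exact: val_inj.
apply: (@sub_finite_set _ _ ((val : psupp g -> S0) @^-1` A)).
  by move=> y /= Fy; apply: contrapT => /A0.
by apply: finite_preimage => // u v _ _; exact: val_inj.
Qed.

Lemma fsupp_pmat (f g : pobj)
    (F : forall (x : psupp f) (y : psupp g), ab_hom (f x) (g y)) :
  (forall x, finite_set [set y | F x y <> 0]) ->
  infinite_set (psupp g) -> forall x : psupp f,
    exists A : set S0, [/\ finite_set A, A `<=` psupp g
      & forall y : psupp g, ~ A (val y) -> F x y = 0].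
Proof.
move=> fF _ x; exists (val @` [set y | F x y <> 0]); split.
- exact: finite_image.
- by move=> _ [y _ <-]; exact/set_mem/valP.
- by move=> y; apply: contra_notP => Fy; exists y.
Qed.

Lemma ab_comp0m (X Y Z : ab_obj C) (f : ab_hom X Y) :
  ab_comp (0 : ab_hom Y Z) f = 0.
Proof.
by apply: (addrI (ab_comp (0 : ab_hom Y Z) f)); rewrite -ab_compDl !addr0.
Qed.

Lemma ab_compm0 (X Y Z : ab_obj C) (f : ab_hom Y Z) :
  ab_comp f (0 : ab_hom X Y) = 0.
Proof.
by apply: (addrI (ab_comp f (0 : ab_hom X Y))); rewrite -ab_compDr !addr0.
Qed.

Lemma ab_comp_neq0 (X Y Z : ab_obj C) (g : ab_hom Y Z) (f : ab_hom X Y) :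
  ab_comp g f <> 0 -> g <> 0 /\ f <> 0.
Proof.
by move=> gf; split=> E; apply: gf; rewrite E ?ab_comp0m ?ab_compm0.
Qed.

(* [delta F i j phi] is "Kronecker delta of [i], [j] times [phi]": it is [phi]
    if [i = j] (transported along that equality) and zero otherwise. *)
Definition delta (I : Type) (F : I -> C) (X : C) (i j : I)
    (phi : ab_hom X (F i)) : ab_hom X (F j) :=
  match pselect (i = j) with
  | left e => eq_rect i (fun k => ab_hom X (F k)) phi j e
  | right _ => 0
  end.

Arguments delta {I} F {X} i j phi.

Lemma delta0 (I : Type) (F : I -> C) (X : C) (i j : I)
  (phi : ab_hom X (F i)) : i <> j -> delta F i j phi = 0.
Proof. by rewrite /delta; case: pselect. Qed.

Section Comp.
Variables (f g h : pobj) (G : pmor g h) (F : pmor f g).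

Definition pcomp_mat (x : psupp f) (y : psupp h) : ab_hom (f x) (h y) :=
  fsum (fun z : psupp g => ab_comp (G z y) (F x z)).

Lemma pcomp_supp (x : psupp f) (y : psupp h) :
  fsupp (fun z : psupp g => ab_comp (G z y) (F x z)).
Proof.
apply: sub_finite_set (pmat_supp F x) => z /= /ab_comp_neq0[]//.
Qed.

Lemma pcomp_fin : infinite_set (psupp h) -> forall x : psupp f,
  exists A : set S0, [/\ finite_set A, A `<=` psupp h
    & forall y : psupp h, ~ A (val y) -> pcomp_mat x y = 0].
Proof.
apply: fsupp_pmat => x.
apply: (@sub_finite_set _ _ (\bigcup_(z in [set z | F x z <> 0])
                               [set y | G z y <> 0])); last first.
  by apply: bigcup_finite => [|z _]; exact: pmat_supp.
move=> y /=; apply: contra_notP => yn; rewrite /pcomp_mat /fsum fsbig1// => z _.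
apply: contrapT => /ab_comp_neq0[Gz Fz]; apply: yn; exists z => //.
Qed.

Definition pcomp : pmor f h := PMor pcomp_fin.
End Comp.

Definition pid_mat (f : pobj) (x y : psupp f) : ab_hom (f x) (f y) :=
  delta f x y (ab_id (f x)).

Lemma delta_fin (f g : pobj)
    (F : forall (x : psupp f) (y : psupp g), ab_hom (f x) (g y))
    (s : psupp f -> psupp g) :
  (forall x y, y <> s x -> F x y = 0) ->
  infinite_set (psupp g) -> forall x : psupp f,
    exists A : set S0, [/\ finite_set A, A `<=` psupp g
      & forall y : psupp g, ~ A (val y) -> F x y = 0].
Proof.
move=> F0; apply: fsupp_pmat => x.
apply: (@sub_finite_set _ _ [set s x]) => // y /=.
by apply: contra_notP; exact: F0.
Qed.

Lemma pid_fin (f : pobj) : infinite_set (psupp f) -> forall x : psupp f,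
  exists A : set S0, [/\ finite_set A, A `<=` psupp f
    & forall y : psupp f, ~ A (val y) -> pid_mat x y = 0].
Proof.
by apply: (delta_fin (s := id)) => x y yx; apply: delta0 => xy; exact: yx.
Qed.

Definition pid (f : pobj) : pmor f f := PMor (@pid_fin f).

Lemma pid_diag (f : pobj) (x : psupp f) : pid f x x = ab_id (f x).
Proof.
rewrite /= /pid_mat /delta; case: pselect => // e.
by rewrite (Prop_irrelevance e erefl).
Qed.

Lemma pid_off (f : pobj) (x y : psupp f) : y <> x -> pid f x y = 0.
Proof. by move=> yx; apply: delta0 => xy; exact: yx. Qed.

Lemma pcompA (f g h k : pobj) (H : pmor h k) (G : pmor g h) (F : pmor f g) :
  pcomp H (pcomp G F) = pcomp (pcomp H G) F.
Proof.
apply: pmor_eq => x y /=; rewrite /pcomp_mat /=.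
transitivity (fsum (fun w : psupp h => fsum (fun z : psupp g =>
    ab_comp (H w y) (ab_comp (G z w) (F x z))))).
  apply: eq_fsum => w.
  apply: (fsum_map (h := ab_comp (H w y))); [exact: ab_compDr|exact: pcomp_supp].
have [r ur rF] : exists2 r : seq {classic (psupp g)}, uniq r &
    forall z : {classic (psupp g)}, F x z <> 0 -> z \in r.
  have /= fF := pmat_supp F x.
  exists (fset_set ([set z | F x z <> 0] : set {classic (psupp g)})).
    exact: fset_uniq.
  by move=> z Fz; rewrite in_fset_set// inE.
have [s us sG] : exists2 s : seq {classic (psupp h)}, uniq s &
    forall z w, F x z <> 0 -> G z w <> 0 -> (w : {classic (psupp h)}) \in s.
  pose B : set {classic (psupp h)} := \bigcup_(z in [set z | F x z <> 0])
                               [set y | G z y <> 0].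
  have fB : finite_set B by apply: bigcup_finite => [|z _]; exact: pmat_supp.
  exists (fset_set B); first exact: fset_uniq.
  by move=> z w Fz Gz; rewrite in_fset_set// inE; exists z.
rewrite (fsum_exchange us ur); last first.
  move=> w z /ab_comp_neq0[_ /ab_comp_neq0[Gz Fz]].
  by rewrite (sG z w)//=; exact: rF.
apply: eq_fsum => z; under eq_fsum do rewrite ab_compA.
rewrite -(fsum_map (h := fun u => ab_comp u (F x z)))//; last exact: pcomp_supp.
by move=> a b; exact: ab_compDl.
Qed.

Lemma pcomp1m (f g : pobj) (F : pmor f g) : pcomp (pid g) F = F.
Proof.
apply: pmor_eq => x y; rewrite /= /pcomp_mat (@fsum1 _ _ _ y).
  by rewrite pid_diag ab_comp1m.
by move=> z zy; rewrite pid_off ?ab_comp0m// => yz; exact: zy.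
Qed.

Lemma pcompm1 (f g : pobj) (F : pmor f g) : pcomp F (pid f) = F.
Proof.
apply: pmor_eq => x y; rewrite /= /pcomp_mat (@fsum1 _ _ _ x).
  by rewrite pid_diag ab_compm1.
by move=> z zy; rewrite pid_off ?ab_compm0.
Qed.

Definition pow_cat : category := Category pcompA pcomp1m pcompm1.

(* Matrices with exactly one possibly nonzero entry in each row. *)

Notation arr := (@Arrow (ab_cat C) _ _).

Lemma arr_delta (I : Type) (F : I -> C) (X : C) (i j : I)
  (phi : ab_hom X (F i)) : i = j -> arr (delta F i j phi) = arr phi.
Proof.
move=> ij; subst j; rewrite /delta; case: pselect => // e.
by rewrite (Prop_irrelevance e erefl).
Qed.

Definition monomial (f g : pobj) (M : pmor f g) (s : psupp f -> psupp g)
    (Phi : psupp f -> arrow C) : Prop :=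
  (forall x, arr (M x (s x)) = Phi x) /\ (forall x y, y <> s x -> M x y = 0).

Lemma monomial_pid (f : pobj) :
  monomial (pid f) id (fun x => arr (ab_id (f x))).
Proof. by split=> [x|x y]; [rewrite pid_diag|exact: pid_off]. Qed.

Lemma monomial_eq (f g : pobj) (M N : pmor f g) s t Phi Psi :
  monomial M s Phi -> monomial N t Psi -> s =1 t -> Phi =1 Psi -> M = N.
Proof.
move=> [Ms M0] [Nt N0] /funext st PhiPsi; subst t; apply: pmor_eq => x y.
have [->|ys] := pselect (y = s x); last by rewrite M0// N0.
by apply: (@arrow_inj C); rewrite Ms Nt.
Qed.

Lemma pcomp_monomialr (f g h : pobj) (N : pmor g h) (M : pmor f g) s Phi x y :
  monomial M s Phi -> pcomp N M x y = ab_comp (N (s x) y) (M x (s x)).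
Proof.
move=> [_ M0]; rewrite /= /pcomp_mat (@fsum1 _ _ _ (s x))// => z zs.
by rewrite M0// ab_compm0.
Qed.

Lemma pcomp_monomiall (f g h : pobj) (N : pmor g h) (M : pmor f g) t Psi x z :
  monomial N t Psi -> injective t ->
  pcomp N M x (t z) = ab_comp (N z (t z)) (M x z).
Proof.
move=> [_ N0] tI; rewrite /= /pcomp_mat (@fsum1 _ _ _ z)// => z' z'z.
by rewrite N0 ?ab_comp0m// => /tI zz'; exact: z'z.
Qed.

Lemma monomial_comp (f g h : pobj) (N : pmor g h) (M : pmor f g) s t Phi Psi :
  monomial N t Psi -> monomial M s Phi ->
  monomial (pcomp N M) (t \o s) (fun x => acomp (Psi (s x)) (Phi x)).
Proof.
move=> mN mM; split=> [x|x y yts]; rewrite (pcomp_monomialr _ _ _ mM).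
  by rewrite -(proj1 mN) -(proj1 mM) acompE.
by rewrite (proj2 mN)// ab_comp0m.
Qed.

Lemma monomial_nat (f g f' g' : pobj) (M : pmor f g) (M' : pmor f' g')
    (F : pmor f f') (G : pmor g g') s s' Phi Phi' :
  monomial M s Phi -> monomial M' s' Phi' -> bijective s' ->
  (forall x x', acomp (Phi' x') (arr (F x x'))
     = acomp (arr (G (s x) (s' x'))) (Phi x)) ->
  pcomp M' F = pcomp G M.
Proof.
move=> mM mM' s'b FG; apply: pmor_eq => x y.
have [s'' s''K s'K] := s'b; rewrite -(s'K y).
rewrite (pcomp_monomiall _ _ _ mM' (bij_inj s'b)) (pcomp_monomialr _ _ _ mM).
move: (FG x (s'' y)); rewrite -(proj1 mM') -(proj1 mM) !acompE.
exact: arrow_inj.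
Qed.

Lemma monomial_iso (f g : pobj) (M : pmor f g) s Phi : monomial M s Phi ->
  bijective s -> (forall x, is_iso (amor (Phi x))) ->
  is_iso (C := pow_cat) M.
Proof.
move=> mM [t sK tK] Phi_iso.
have Miso x : is_iso (C := C) (M x (s x)).
  by have := Phi_iso x; rewrite -(proj1 mM).
pose psi x : ab_hom (g (s x)) (f x) := sval (cid (Miso x)).
have psi1 x : acomp (arr (psi x)) (arr (M x (s x))) = arr (ab_id (f x)).
  by rewrite acompE /psi; case: cid => h [/= ? ?]; congr Arrow.
have psi2 x : acomp (arr (M x (s x))) (arr (psi x)) = arr (ab_id (g (s x))).
  by rewrite acompE /psi; case: cid => h [/= ? ?]; congr Arrow.
pose N0 (y : psupp g) (x : psupp f) : ab_hom (g y) (f x) :=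
  match pselect (s x = y) with
  | left e => eq_rect (s x) (fun y => ab_hom (g y) (f x)) (psi x) y e
  | right _ => 0
  end.
have N0fin := @delta_fin g f N0 t.
have N00 y x : x <> t y -> N0 y x = 0.
  by rewrite /N0; case: pselect => // e; subst y; rewrite sK.
exists (PMor (N0fin N00)).
have mN : monomial (PMor (N0fin N00)) t (fun y => arr (psi (t y))).
  split=> // y; rewrite /= /N0; case: pselect => [e|].
    have tE y' (e' : s (t y) = y') :
        arr (eq_rect (s (t y)) (fun z => ab_hom (g z) (f (t y)))
               (psi (t y)) y' e') = arr (psi (t y)) by case: y' / e'.
    exact: tE.
  by case; exact: tK.
split.
  apply: (monomial_eq (monomial_comp mN mM) (monomial_pid f)) => x /=.
    by rewrite sK.
  by rewrite -(proj1 mM) sK psi1.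
apply: (monomial_eq (monomial_comp mM mN) (monomial_pid g)) => y /=.
  by rewrite tK.
by rewrite -(proj1 mM) psi2 tK.
Qed.

Section Tensor.
Variables (M : monoidal C) (hM : bilinear_tens M).
Variables (gam : S0 * S0 -> S0) (hgam : bijective gam) (ast : S0).

Definition ptens_supp (f g : pobj) : set S0 :=
  gam @` (psupp f `*` psupp g).

Section Pairs.
Variables f g : pobj.

Definition ppair (x : psupp f) (y : psupp g) : ptens_supp f g :=
  exist _ (gam (val x, val y))
    (mem_set (imageP gam (conj (set_mem (valP x)) (set_mem (valP y))))).

(* [pr1] and [pr2] recover [x] and [y] from an index [gam (x, y)]. *)
Definition pr1 (s : ptens_supp f g) : psupp f :=
  let: exist2 p pfg _ := cid2 (set_mem (valP s)) in
  exist _ p.1 (mem_set (proj1 pfg)).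

Definition pr2 (s : ptens_supp f g) : psupp g :=
  let: exist2 p pfg _ := cid2 (set_mem (valP s)) in
  exist _ p.2 (mem_set (proj2 pfg)).

Lemma ppairK (s : ptens_supp f g) : ppair (pr1 s) (pr2 s) = s.
Proof.
apply: val_inj; rewrite /= /pr1 /pr2; case: cid2 => -[a b] /= ? E; exact: E.
Qed.

Lemma ppair_inj x y x' y' : ppair x y = ppair x' y' -> x = x' /\ y = y'.
Proof.
move=> /(congr1 val)/=/(bij_inj hgam)[xx' yy'].
by split; exact: val_inj.
Qed.

Lemma pr1K x y : pr1 (ppair x y) = x.
Proof. by have /ppair_inj[] := ppairK (ppair x y). Qed.

Lemma pr2K x y : pr2 (ppair x y) = y.
Proof. by have /ppair_inj[] := ppairK (ppair x y). Qed.

End Pairs.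

Definition ptens (f g : pobj) : pobj :=
  @PObj (ptens_supp f g) (fun s => tens M (f (pr1 s)) (g (pr2 s))).

Lemma ptensE (f g : pobj) (x : psupp f) (y : psupp g) :
  ptens f g (ppair x y) = tens M (f x) (g y).
Proof. by rewrite /= pr1K pr2K. Qed.

Definition punit : pobj := @PObj [set ast] (fun _ => tunit M).

Section TensM.
Variables (f f' g g' : pobj) (F : pmor f f') (G : pmor g g').

Definition ptensm_mat (s : psupp (ptens f g)) (t : psupp (ptens f' g')) :
    ab_hom (ptens f g s) (ptens f' g' t) :=
  ab_tensm M (F (pr1 s) (pr1 t)) (G (pr2 s) (pr2 t)).

Lemma ab_tensm0l (X X' Y Y' : C) (v : ab_hom Y Y') :
  ab_tensm M (0 : ab_hom X X') v = 0.
Proof.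
by apply: (addrI (ab_tensm M (0 : ab_hom X X') v)); rewrite -(proj1 hM) !addr0.
Qed.

Lemma ab_tensm0r (X X' Y Y' : C) (u : ab_hom X X') :
  ab_tensm M u (0 : ab_hom Y Y') = 0.
Proof.
by apply: (addrI (ab_tensm M u (0 : ab_hom Y Y'))); rewrite -(proj2 hM) !addr0.
Qed.

Lemma ab_tensm_neq0 (X X' Y Y' : C) (u : ab_hom X X') (v : ab_hom Y Y') :
  ab_tensm M u v <> 0 -> u <> 0 /\ v <> 0.
Proof.
by move=> uv; split=> E; apply: uv; rewrite E ?ab_tensm0l ?ab_tensm0r.
Qed.

Lemma ptensm_fin : infinite_set (psupp (ptens f' g')) ->
  forall s : psupp (ptens f g), exists A : set S0,
    [/\ finite_set A, A `<=` psupp (ptens f' g')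
      & forall t : psupp (ptens f' g'), ~ A (val t) -> ptensm_mat s t = 0].
Proof.
apply: fsupp_pmat => s.
apply: (@sub_finite_set _ _ ((fun p => ppair p.1 p.2) @`
   ([set x | F (pr1 s) x <> 0] `*` [set y | G (pr2 s) y <> 0]))).
  move=> t /= /ab_tensm_neq0 FG; exists (pr1 t, pr2 t) => //=; exact: ppairK.
by apply: finite_image; apply: finite_setX; exact: pmat_supp.
Qed.

Definition ptensm : pmor (ptens f g) (ptens f' g') := PMor ptensm_fin.

End TensM.

Lemma arr_ptensm (f f' g g' : pobj) (F : pmor f f') (G : pmor g g') s t :
  arr (ptensm F G s t)
  = atens M (arr (F (pr1 s) (pr1 t))) (arr (G (pr2 s) (pr2 t))).
Proof. by []. Qed.

Lemma monomial_ptensm (f f' g g' : pobj) (F : pmor f f') (G : pmor g g')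
    a b Phi Psi : monomial F a Phi -> monomial G b Psi ->
  monomial (ptensm F G) (fun s => ppair (a (pr1 s)) (b (pr2 s)))
    (fun s => atens M (Phi (pr1 s)) (Psi (pr2 s))).
Proof.
move=> [Fa F0] [Gb G0]; split=> [s|s t tab].
  by rewrite arr_ptensm pr1K pr2K Fa Gb.
rewrite /= /ptensm_mat.
have [E|ne] := pselect (pr1 t = a (pr1 s)); last first.
  by rewrite F0// ab_tensm0l.
rewrite G0 ?ab_tensm0r// => E'; apply: tab.
by rewrite -[t]ppairK E E'.
Qed.

Lemma ptensm_id (f g : pobj) : ptensm (pid f) (pid g) = pid (ptens f g).
Proof.
apply: (monomial_eq (monomial_ptensm (monomial_pid f) (monomial_pid g))
  (monomial_pid _)) => s; first exact: ppairK.
by rewrite /atens /= (tensm_id M).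
Qed.

Lemma ptensm_comp (f f' f'' g g' g'' : pobj) (F' : pmor f' f'')
    (F : pmor f f') (G' : pmor g' g'') (G : pmor g g') :
  ptensm (pcomp F' F) (pcomp G' G) = pcomp (ptensm F' G') (ptensm F G).
Proof.
apply: pmor_eq => s t; rewrite /= /ptensm_mat /pcomp_mat /=.
have hF := pcomp_supp F' F (pr1 s) (pr1 t).
have hG := pcomp_supp G' G (pr2 s) (pr2 t).
have [r ur rF] := fsupp_seq hF; have [q uq qG] := fsupp_seq hG.
rewrite (fsum_map (h := fun u => ab_tensm M u _))//; last first.
  by move=> a b; exact: (proj1 hM).
under eq_fsum => x.
  rewrite (fsum_map (h := ab_tensm M _))//; last by move=> a b; exact: (proj2 hM).
  over.
rewrite (fsumE ur); last first.
  move=> x; apply: contra_notT => xr; rewrite /fsum fsbig1// => y _.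
  apply: contrapT => /ab_tensm_neq0[/rF]; by rewrite (negbTE xr).
under eq_bigr => x _.
  rewrite (fsumE uq); last by move=> y /ab_tensm_neq0[_ /qG].
  over.
pose H (x : psupp f') (y : psupp g') := ab_tensm M
  (ab_comp (F' x (pr1 t)) (F (pr1 s) x)) (ab_comp (G' y (pr2 t)) (G (pr2 s) y)).
transitivity (fsum (fun z : ptens_supp f' g' => H (pr1 z) (pr2 z))); last first.
  by apply: eq_fsum => z; exact: (tensm_comp M).
pose rq := [seq (ppair x y : {classic (ptens_supp f' g')}) | x <- r, y <- q].
rewrite (@fsumE _ _ _ rq); first last.
- move=> z /ab_tensm_neq0[/rF zr /qG zq].
  have := allpairs_f
    (fun (x : {classic (psupp f')}) (y : {classic (psupp g')}) =>
       ppair x y : {classic (ptens_supp f' g')}) zr zq.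
  by rewrite ppairK.
- by rewrite /rq; apply: (@allpairs_uniq {classic (psupp f')}
    {classic (psupp g')} {classic (ptens_supp f' g')}) => // -[x y] [x' y'] _ _ /= /ppair_inj[-> ->].
rewrite /rq big_allpairs_dep; apply: eq_bigr => x _; apply: eq_bigr => y _.
by rewrite pr1K pr2K.
Qed.

Section Assoc.
Variables f g h : pobj.

(* [coordl], [coordr] read off the indices [x, y, z] from [gam (gam (x, y), z)] and
   from [gam (x, gam (y, z))]. *)
Definition coordl (s : psupp (ptens (ptens f g) h)) :
    psupp f * (psupp g * psupp h) :=
  (pr1 (pr1 s), (pr2 (pr1 s), pr2 s)).

Definition coordr (t : psupp (ptens f (ptens g h))) :
    psupp f * (psupp g * psupp h) :=
  (pr1 t, (pr1 (pr2 t), pr2 (pr2 t))).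

Definition reassoc (s : psupp (ptens (ptens f g) h)) :
    psupp (ptens f (ptens g h)) :=
  @ppair f (ptens g h) (pr1 (pr1 s)) (@ppair g h (pr2 (pr1 s)) (pr2 s)).

Definition reassocV (t : psupp (ptens f (ptens g h))) :
    psupp (ptens (ptens f g) h) :=
  @ppair (ptens f g) h (@ppair f g (pr1 t) (pr1 (pr2 t))) (pr2 (pr2 t)).

Lemma reassocK : cancel reassoc reassocV.
Proof. by move=> s; rewrite /reassoc /reassocV !(pr1K, pr2K, ppairK). Qed.

Lemma reassocVK : cancel reassocV reassoc.
Proof. by move=> s; rewrite /reassoc /reassocV !(pr1K, pr2K, ppairK). Qed.

Lemma coordr_reassoc s : coordr (reassoc s) = coordl s.
Proof. by rewrite /coordr /reassoc !(pr1K, pr2K). Qed.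

Lemma coordl_reassocV t : coordl (reassocV t) = coordr t.
Proof. by rewrite /coordl /reassocV !(pr1K, pr2K). Qed.

(* When [C] is strict, [assoc M _ _ _] below is an identity morphism. *)
Definition passoc_mat (s : psupp (ptens (ptens f g) h))
    (t : psupp (ptens f (ptens g h))) :
    ab_hom (ptens (ptens f g) h s) (ptens f (ptens g h) t) :=
  delta (fun p => tens M (f p.1) (tens M (g p.2.1) (h p.2.2)))
    (coordl s) (coordr t) (assoc M _ _ _).

Definition passocV_mat (t : psupp (ptens f (ptens g h)))
    (s : psupp (ptens (ptens f g) h)) :
    ab_hom (ptens f (ptens g h) t) (ptens (ptens f g) h s) :=
  delta (fun p => tens M (tens M (f p.1) (g p.2.1)) (h p.2.2))
    (coordr t) (coordl s) (assocV M _ _ _).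

Lemma coordr_inj : injective coordr.
Proof.
apply: (can_inj (g := fun p => @ppair f (ptens g h) p.1 (ppair p.2.1 p.2.2))).
by move=> t; rewrite /coordr /= !ppairK.
Qed.

Lemma coordl_inj : injective coordl.
Proof.
apply: (can_inj (g := fun p => @ppair (ptens f g) h (ppair p.1 p.2.1) p.2.2)).
by move=> t; rewrite /coordl /= !ppairK.
Qed.

Lemma passoc_off s t : t <> reassoc s -> passoc_mat s t = 0.
Proof.
move=> ts; rewrite /passoc_mat delta0// -coordr_reassoc => /coordr_inj E.
exact: ts.
Qed.

Lemma passocV_off t s : s <> reassocV t -> passocV_mat t s = 0.
Proof.
move=> ts; rewrite /passocV_mat delta0// -coordl_reassocV => /coordl_inj E.
exact: ts.
Qed.

Definition passoc : pmor (ptens (ptens f g) h) (ptens f (ptens g h)) :=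
  PMor (delta_fin passoc_off).

Definition passocV : pmor (ptens f (ptens g h)) (ptens (ptens f g) h) :=
  PMor (delta_fin passocV_off).

Lemma monomial_passoc : monomial passoc reassoc
  (fun s => arr (assoc M (f (pr1 (pr1 s))) (g (pr2 (pr1 s))) (h (pr2 s)))).
Proof.
split=> [s|s t]; last exact: passoc_off.
exact: (arr_delta (F := fun p => _) _ (esym (coordr_reassoc s))).
Qed.

Lemma monomial_passocV : monomial passocV reassocV
  (fun t => arr (assocV M (f (pr1 t)) (g (pr1 (pr2 t))) (h (pr2 (pr2 t))))).
Proof.
split=> [s|s t]; last exact: passocV_off.
exact: (arr_delta (F := fun p => _) _ (esym (coordl_reassocV s))).
Qed.

Lemma passocK : pcomp passocV passoc = pid (ptens (ptens f g) h).
Proof.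
apply: (monomial_eq (monomial_comp monomial_passocV monomial_passoc)
  (monomial_pid _)) => s /=; first exact: reassocK.
by rewrite /reassoc !(pr1K, pr2K) acompE (assocK M).
Qed.

Lemma passocVK : pcomp passoc passocV = pid (ptens f (ptens g h)).
Proof.
apply: (monomial_eq (monomial_comp monomial_passoc monomial_passocV)
  (monomial_pid _)) => s /=; first exact: reassocVK.
by rewrite /reassocV !(pr1K, pr2K) acompE (assocVK M).
Qed.

End Assoc.

Lemma atensE (X X' Y Y' : C) (u : ab_hom X X') (v : ab_hom Y Y') :
  atens M (arr u) (arr v) = arr (ab_tensm M u v).
Proof. by []. Qed.

Lemma passoc_nat (f f' g g' h h' : pobj) (F : pmor f f') (G : pmor g g')
    (H : pmor h h') :
  pcomp (passoc f' g' h') (ptensm (ptensm F G) H)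
  = pcomp (ptensm F (ptensm G H)) (passoc f g h).
Proof.
apply: (monomial_nat (monomial_passoc f g h) (monomial_passoc f' g' h')).
  by exists (@reassocV f' g' h'); [exact: reassocK|exact: reassocVK].
move=> x x'; rewrite !arr_ptensm /reassoc !(pr1K, pr2K) !atensE !acompE.
by congr Arrow; exact: (assoc_nat M).
Qed.

Section Unit.
Variable f : pobj.

Definition star : psupp punit :=
  exist (fun x => x \in [set ast]) ast (mem_set erefl).

Lemma punitE (u : psupp punit) : u = star.
Proof. by apply: val_inj; exact: (set_mem (valP u)). Qed.

Definition prunit_mat (s : psupp (ptens f punit)) (x : psupp f) :
    ab_hom (ptens f punit s) (f x) :=
  delta f (pr1 s) x (runit M (f (pr1 s))).

Definition plunit_mat (s : psupp (ptens punit f)) (x : psupp f) :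
    ab_hom (ptens punit f s) (f x) :=
  delta f (pr2 s) x (lunit M (f (pr2 s))).

Lemma prunit_off s x : x <> pr1 s -> prunit_mat s x = 0.
Proof. by move=> xs; apply: delta0 => sx; exact: xs. Qed.

Lemma plunit_off s x : x <> pr2 s -> plunit_mat s x = 0.
Proof. by move=> xs; apply: delta0 => sx; exact: xs. Qed.

Definition prunit : pmor (ptens f punit) f :=
  PMor (@delta_fin (ptens f punit) f _ _ prunit_off).

Definition plunit : pmor (ptens punit f) f :=
  PMor (@delta_fin (ptens punit f) f _ _ plunit_off).

Lemma monomial_prunit :
  monomial prunit (@pr1 _ _) (fun s => arr (runit M (f (pr1 s)))).
Proof.
split=> [s|s t]; last exact: prunit_off.
exact: (arr_delta (F := f) _ (erefl (pr1 s))).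
Qed.

Lemma monomial_plunit :
  monomial plunit (@pr2 _ _) (fun s => arr (lunit M (f (pr2 s)))).
Proof.
split=> [s|s t]; last exact: plunit_off.
exact: (arr_delta (F := f) _ (erefl (pr2 s))).
Qed.

Lemma bij_pr1 : bijective (@pr1 f punit).
Proof.
exists (fun x => ppair x star) => [s|x]; last exact: pr1K.
by rewrite -(punitE (pr2 s)); exact: ppairK.
Qed.

Lemma bij_pr2 : bijective (@pr2 punit f).
Proof.
exists (fun x => ppair star x) => [s|x]; last exact: pr2K.
by rewrite -(punitE (pr1 s)); exact: ppairK.
Qed.

Lemma prunit_iso : is_iso (C := pow_cat) prunit.
Proof.
by apply: (monomial_iso monomial_prunit bij_pr1) => s; exact: (runit_iso M).
Qed.

Lemma plunit_iso : is_iso (C := pow_cat) plunit.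
Proof.
by apply: (monomial_iso monomial_plunit bij_pr2) => s; exact: (lunit_iso M).
Qed.

End Unit.

Lemma prunit_nat (f f' : pobj) (F : pmor f f') :
  pcomp (prunit f') (ptensm F (pid punit)) = pcomp F (prunit f).
Proof.
apply: (monomial_nat (monomial_prunit f) (monomial_prunit f') (bij_pr1 f')).
move=> s t; rewrite arr_ptensm (punitE (pr2 s)) (punitE (pr2 t)) pid_diag.
by rewrite atensE !acompE; congr Arrow; exact: (runit_nat M).
Qed.

Lemma plunit_nat (f f' : pobj) (F : pmor f f') :
  pcomp (plunit f') (ptensm (pid punit) F) = pcomp F (plunit f).
Proof.
apply: (monomial_nat (monomial_plunit f) (monomial_plunit f') (bij_pr2 f')).
move=> s t; rewrite arr_ptensm (punitE (pr1 s)) (punitE (pr1 t)) pid_diag.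
by rewrite atensE !acompE; congr Arrow; exact: (lunit_nat M).
Qed.

Lemma ppentagon (f g h k : pobj) :
  pcomp (pcomp (ptensm (pid f) (passoc g h k)) (passoc f (ptens g h) k))
    (ptensm (passoc f g h) (pid k))
  = pcomp (passoc f g (ptens h k)) (passoc (ptens f g) h k).
Proof.
apply: (monomial_eq
  (monomial_comp
    (monomial_comp (monomial_ptensm (monomial_pid f) (monomial_passoc g h k))
      (monomial_passoc f (ptens g h) k))
    (monomial_ptensm (monomial_passoc f g h) (monomial_pid k)))
  (monomial_comp (monomial_passoc f g (ptens h k))
     (monomial_passoc (ptens f g) h k))) => s.
  by rewrite /= /reassoc !(pr1K, pr2K).
rewrite /= /reassoc !(pr1K, pr2K) !atensE !acompE; congr Arrow.
exact: (pentagon M).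
Qed.

Lemma ptriangle (f g : pobj) :
  pcomp (ptensm (pid f) (plunit g)) (passoc f punit g)
  = ptensm (prunit f) (pid g).
Proof.
apply: (monomial_eq
  (monomial_comp (monomial_ptensm (monomial_pid f) (monomial_plunit g))
    (monomial_passoc f punit g))
  (monomial_ptensm (monomial_prunit f) (monomial_pid g))) => s.
  by rewrite /= /reassoc !(pr1K, pr2K).
rewrite /= /reassoc !(pr1K, pr2K) !atensE !acompE; congr Arrow.
exact: (triangle M).
Qed.

Definition pow_monoidal : monoidal pow_cat :=
  @Monoidal pow_cat ptens punit ptensm ptensm_id ptensm_comp
    passoc passocV passocK passocVK passoc_nat
    prunit prunit_iso prunit_nat plunit plunit_iso plunit_nat
    ppentagon ptriangle.

Variable B : braiding M.

Section Braid.
Variables f g : pobj.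

Definition pbraid_mat (s : psupp (ptens f g)) (t : psupp (ptens g f)) :
    ab_hom (ptens f g s) (ptens g f t) :=
  delta (fun p => tens M (g p.2) (f p.1)) (pr1 s, pr2 s) (pr2 t, pr1 t)
    (braid B (f (pr1 s)) (g (pr2 s))).

Definition pswap (s : psupp (ptens f g)) : psupp (ptens g f) :=
  @ppair g f (pr2 s) (pr1 s).

Lemma pbraid_off s t : t <> pswap s -> pbraid_mat s t = 0.
Proof.
move=> ts; rewrite /pbraid_mat delta0// => -[E1 E2]; apply: ts.
by rewrite /pswap E1 E2 ppairK.
Qed.

Definition pbraid : pmor (ptens f g) (ptens g f) :=
  PMor (@delta_fin (ptens f g) (ptens g f) _ _ pbraid_off).

Lemma monomial_pbraid : monomial pbraid pswap
  (fun s => arr (braid B (f (pr1 s)) (g (pr2 s)))).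
Proof.
split=> [s|s t]; last exact: pbraid_off.
have E : (pr1 s, pr2 s) = (pr2 (pswap s), pr1 (pswap s)).
  by rewrite /pswap pr1K pr2K.
exact: (arr_delta (F := fun p => _) _ E).
Qed.

End Braid.

Lemma pswapK (f g : pobj) : cancel (@pswap f g) (@pswap g f).
Proof. by move=> s; rewrite /pswap pr1K pr2K ppairK. Qed.

Lemma pbraid_iso (f g : pobj) : is_iso (C := pow_cat) (pbraid f g).
Proof.
apply: (monomial_iso (monomial_pbraid f g)).
  by exists (@pswap g f); exact: pswapK.
by move=> s; exact: (braid_iso B).
Qed.

Lemma pbraid_nat (f f' g g' : pobj) (F : pmor f f') (G : pmor g g') :
  pcomp (pbraid f' g') (ptensm F G) = pcomp (ptensm G F) (pbraid f g).
Proof.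
apply: (monomial_nat (monomial_pbraid f g) (monomial_pbraid f' g')).
  by exists (@pswap g' f'); exact: pswapK.
move=> s t; rewrite !arr_ptensm /pswap !(pr1K, pr2K) !atensE !acompE.
by congr Arrow; exact: (braid_nat B).
Qed.

Lemma phexagon1 (f g h : pobj) :
  pcomp (pcomp (passoc g h f) (pbraid f (ptens g h))) (passoc f g h)
  = pcomp (pcomp (ptensm (pid g) (pbraid f h)) (passoc g f h))
      (ptensm (pbraid f g) (pid h)).
Proof.
apply: (monomial_eq
  (monomial_comp (monomial_comp (monomial_passoc g h f)
     (monomial_pbraid f (ptens g h))) (monomial_passoc f g h))
  (monomial_comp (monomial_comp
     (monomial_ptensm (monomial_pid g) (monomial_pbraid f h))
     (monomial_passoc g f h))
     (monomial_ptensm (monomial_pbraid f g) (monomial_pid h)))) => s.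
  by rewrite /= /reassoc /pswap !(pr1K, pr2K).
rewrite /= /reassoc /pswap !(pr1K, pr2K) !atensE !acompE; congr Arrow.
exact: (hexagon1 B).
Qed.

Lemma phexagon2 (f g h : pobj) :
  pcomp (pcomp (passocV h f g) (pbraid (ptens f g) h)) (passocV f g h)
  = pcomp (pcomp (ptensm (pbraid f h) (pid g)) (passocV f h g))
      (ptensm (pid f) (pbraid g h)).
Proof.
apply: (monomial_eq
  (monomial_comp (monomial_comp (monomial_passocV h f g)
     (monomial_pbraid (ptens f g) h)) (monomial_passocV f g h))
  (monomial_comp (monomial_comp
     (monomial_ptensm (monomial_pbraid f h) (monomial_pid g))
     (monomial_passocV f h g))
     (monomial_ptensm (monomial_pid f) (monomial_pbraid g h)))) => s.
  by rewrite /= /reassocV /pswap !(pr1K, pr2K).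
rewrite /= /reassocV /pswap !(pr1K, pr2K) !atensE !acompE; congr Arrow.
exact: (hexagon2 B).
Qed.

Definition pow_braiding : braiding pow_monoidal :=
  @Braiding pow_cat pow_monoidal pbraid pbraid_iso pbraid_nat
    phexagon1 phexagon2.

End Tensor.
End Power.

Arguments delta {C I} F {X} i j phi.

(* Main.v *)
Require Import Defs.
From mathcomp Require Import all_boot ssralg.
From mathcomp Require Import boolp classical_sets cardinality.

Local Open Scope classical_set_scope.

(** The matrix of [Theta f] is diagonal, with the twists [theta (f x)] of the
    entries of [f] on the diagonal.  Each axiom of a twist for [Theta] is an
    equation between matrices, and it reduces, entry by entry, to the same
    axiom for [theta].  Composing [F] with a diagonal matrix composes its
    entry [F x y] with [theta (f x)] on one side or [theta (g y)] on the
    other, which gives naturality ([monomial_nat]); the diagonal of inverses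
    gives invertibility ([monomial_iso]).  For the tensor axiom
    ([diag_tens]), both sides have at most one nonzero entry in each row: on
    the right the tensor product of two diagonal matrices is diagonal, and
    the two braidings exchange the indices [x] and [y] twice, so that the row
    [gam (x, y)] meets only the column [gam (x, y)], in the entry
    [braid B W V \oc braid B V W \oc tensm M (theta V) (theta W)] with
    [V = f x] and [W = g y].

    The indices that are compared here, such as [pr1 (ppair x y)] and [x],
    are equal but not convertible, so that entries of the two sides live in
    different hom-sets; for this reason they are compared as [Arrow]s. *)

Section DiagonalTwist.
Context {C : ab_category} {S0 : Type}.
Variable theta : forall V : C, Hom V V.

Definition diag_mat (f : pobj C S0) (x y : psupp f) : ab_hom (f x) (f y) :=
  delta f x y (theta (f x)).

Lemma diag_off (f : pobj C S0) (x y : psupp f) :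
  y <> x -> diag_mat f x y = 0%R.
Proof. by move=> yx; apply: delta0 => xy; exact: yx. Qed.

Definition diag (f : pobj C S0) : pmor f f :=
  PMor (delta_fin (@diag_off f)).

Lemma monomial_diag (f : pobj C S0) :
  monomial (diag f) id (fun x => Arrow (theta (f x))).
Proof.
by split=> [x|x y]; [exact: (arr_delta (F := f) _ erefl)|exact: diag_off].
Qed.

Lemma diag_iso (f : pobj C S0) :
  (forall V, is_iso (theta V)) -> is_iso (C := pow_cat C S0) (diag f).
Proof.
move=> theta_iso; apply: (monomial_iso (monomial_diag f)); first by exists id.
by move=> x; exact: theta_iso.
Qed.

Lemma diag_nat (f g : pobj C S0) (F : pmor f g) :
  (forall (V W : C) (u : Hom V W), theta W \oc u = u \oc theta V) ->
  Defs.pcomp (diag g) F = Defs.pcomp F (diag f).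
Proof.
move=> theta_nat.
apply: (monomial_nat (monomial_diag f) (monomial_diag g)); first by exists id.
by move=> x y; rewrite !acompE theta_nat.
Qed.

(** Both sides are supported on the diagonal because the index swap of the
    braiding is an involution. *)
Lemma diag_tens (M : monoidal C) (B : braiding M) (hM : bilinear_tens M)
    (gam : S0 * S0 -> S0) (hgam : bijective gam) (f g : pobj C S0) :
  (forall V W : C, theta (tens M V W)
     = braid B W V \oc braid B V W \oc tensm M (theta V) (theta W)) ->
  diag (ptens M gam f g)
  = Defs.pcomp (Defs.pcomp (pbraid gam B g f) (pbraid gam B f g))
      (ptensm hM gam (diag f) (diag g)).
Proof.
move=> theta_tens.
have mB f' g' := monomial_pbraid hgam B f' g'.
have mT := monomial_ptensm hM hgam (monomial_diag f) (monomial_diag g).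
apply: (monomial_eq (monomial_diag _)
  (monomial_comp (monomial_comp (mB g f) (mB f g)) mT)) => s /=.
  by rewrite (pswapK hgam) ppairK.
by rewrite /pswap !(pr1K hgam, pr2K hgam) /atens /= !acompE theta_tens.
Qed.

End DiagonalTwist.

Theorem proposition1p10
  (C : ab_category) (M : monoidal C) (B : braiding M)
  (Mstrict : strict M) (Mbilin : bilinear_tens M)
  (S0 : Type) (S0inf : infinite_set [set: S0])
  (gam : S0 * S0 -> S0) (gam_bij : bijective gam) (ast : S0)
  (theta : forall V : C, Hom V V) (theta_twist : is_twist B theta) :
  exists Theta : forall f : pow_cat C S0, Hom f f,
    is_twist (pow_braiding Mbilin gam_bij ast B) Theta /\
    forall (f : pobj C S0) (x y : psupp f),
      pmat (Theta f) x y = delta f x y (theta (f x)).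
Proof.
have [theta_iso theta_nat theta_tens] := theta_twist.
exists (diag theta); split=> //; split=> [f|f g F|f g].
- exact: diag_iso.
- exact: diag_nat.
- exact: diag_tens.
Qed.
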